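(* Let $\mathcal{A}$ and $\mathcal{B}$ be $C^{*}$-algebras, let $\Xi$ be a Hilbert $\mathcal{A}$-module and $\nabla$ a Hilbert $\mathcal{B}$-module. Let $f:\Xi \rightarrow \nabla$ be a mapping for which there exists a function $\varphi:\Xi^{3}\rightarrow[0,\infty)$ such that $$\| f(\mu x+y)-\mu f(x)-f(y)\| \leq \varphi(x,y,0)$$ and $$\| f(\langle x,y\rangle z)-\langle f(x),f(y)\rangle f(z)\| \leq \varphi(x,y,z)$$ for all $x,y,z\in\Xi$ and all $\mu\in\mathbb{T}$. If there exists $0\leq L<1$ such that $\varphi(x,y,z)\leq 2L\,\varphi\left(\frac{x}{2},\frac{y}{2},\frac{z}{2}\right)$ for all $x,y,z\in\Xi$, then there exists a unique Hilbert $C^{*}$-module homomorphism $H:\Xi\rightarrow\nabla$ such that $$\|f(x)-H(x)\|\leq \frac{1}{2-2L}\varphi(x,x,0)$$ for all $x\in\Xi$.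
   Context: $\mathbb{T}=\{z\in\mathbb{C}:|z|=1\}$. For a $C^{*}$-algebra $\mathcal{A}$, a (left) Hilbert $\mathcal{A}$-module is a complex linear space $\Xi$ with a compatible left $\mathcal{A}$-module action ($\lambda(ax)=(\lambda a)x=a(\lambda x)$) and a map $\langle\cdot,\cdot\rangle:\Xi\times\Xi\to\mathcal{A}$ that is linear in the first variable, satisfies $\langle ax,y\rangle=a\langle x,y\rangle$, $\langle x,y\rangle^{*}=\langle y,x\rangle$, $\langle x,x\rangle\geq 0$ with equality iff $x=0$, and such that $\Xi$ is complete in the norm $\|x\|=\|\langle x,x\rangle\|^{1/2}$. For a Hilbert $\mathcal{A}$-module $\Xi$ and a Hilbert $\mathcal{B}$-module $\nabla$, a Hilbert $C^{*}$-module homomorphism is a $\mathbb{C}$-linear map $H:\Xi\to\nabla$ with $H(\langle x,y\rangle z)=\langle H(x),H(y)\rangle H(z)$ for all $x,y,z\in\Xi$. *)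

(* Defs.v *)
From HB Require Import structures.
From mathcomp Require Import all_boot all_order all_algebra.
From mathcomp Require Import complex.
From mathcomp Require Import reals.
Set Implicit Arguments. Unset Strict Implicit. Unset Printing Implicit Defensive.
Import Order.TTheory GRing.Theory Num.Theory.
Local Open Scope ring_scope.

Definition cabs (R : realType) (z : R[i]) : R :=
  let: Complex a b := z in Num.sqrt (a ^+ 2 + b ^+ 2).

Definition complete_wrt (R : realType) (V : zmodType) (nrm : V -> R) : Prop :=
  forall u : nat -> V,
    (forall e : R, 0 < e -> exists N : nat, forall m n : nat,
        (N <= m)%N -> (N <= n)%N -> nrm (u m - u n) < e) ->
    exists l : V, forall e : R, 0 < e -> exists N : nat, forall n : nat,
        (N <= n)%N -> nrm (u n - l) < e.

Definition cstar_axioms (R : realType) (A : lmodType R[i])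
    (mul : A -> A -> A) (star : A -> A) (nrm : A -> R) : Prop :=
  (
      (forall a b c, mul a (mul b c) = mul (mul a b) c) /\
      (forall a b c, mul (a + b) c = mul a c + mul b c) /\
      (forall a b c, mul a (b + c) = mul a b + mul a c) /\
      (forall (l : R[i]) a b, mul (l *: a) b = l *: mul a b
                           /\ mul a (l *: b) = l *: mul a b) /\
      (forall a b, star (a + b) = star a + star b) /\
      (forall (l : R[i]) a, star (l *: a) = conjc l *: star a) /\
      (forall a, star (star a) = a) /\
      (forall a b, star (mul a b) = mul (star b) (star a)) /\
      (
        (forall a, 0 <= nrm a) /\
        (forall a, nrm a = 0 -> a = 0) /\
        (forall a b, nrm (a + b) <= nrm a + nrm b) /\
        (forall (l : R[i]) a, nrm (l *: a) = cabs l * nrm a) /\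
        (forall a b, nrm (mul a b) <= nrm a * nrm b) /\
        (forall a, nrm (mul (star a) a) = nrm a ^+ 2) /\
        complete_wrt nrm )).

Record cstar_alg (R : realType) := CStarAlg {
  ca_car :> lmodType R[i];
  ca_mul : ca_car -> ca_car -> ca_car;
  ca_star : ca_car -> ca_car;
  ca_norm : ca_car -> R;
  ca_ax : cstar_axioms ca_mul ca_star ca_norm }.

Definition ca_positive (R : realType) (A : cstar_alg R) (a : A) : Prop :=
  exists b : A, a = ca_mul (ca_star b) b.

Definition hmod_axioms (R : realType) (A : cstar_alg R) (X : lmodType R[i])
    (act : A -> X -> X) (ip : X -> X -> A) : Prop :=
  (
      (forall a b x, act (a + b) x = act a x + act b x) /\
      (forall a x y, act a (x + y) = act a x + act a y) /\
      (forall a b x, act (ca_mul a b) x = act a (act b x)) /\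
      (forall (l : R[i]) a x, l *: act a x = act (l *: a) x
                           /\ l *: act a x = act a (l *: x)) /\
      (forall x y z, ip (x + y) z = ip x z + ip y z) /\
      (forall (l : R[i]) x y, ip (l *: x) y = l *: ip x y) /\
      (forall a x y, ip (act a x) y = ca_mul a (ip x y)) /\
      (forall x y, ca_star (ip x y) = ip y x) /\
      ((forall x, ca_positive (ip x x)) /\
          (forall x, ip x x = 0 <-> x = 0) /\
          complete_wrt (fun x => Num.sqrt (ca_norm (ip x x))))).

Record hmod (R : realType) (A : cstar_alg R) := HMod {
  hm_car :> lmodType R[i];
  hm_act : A -> hm_car -> hm_car;
  hm_ip : hm_car -> hm_car -> A;
  hm_ax : hmod_axioms hm_act hm_ip }.

Definition hm_norm (R : realType) (A : cstar_alg R) (X : hmod A) (x : X) : R :=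
  Num.sqrt (ca_norm (hm_ip x x)).

Definition hilbert_hom (R : realType) (A B : cstar_alg R) (X : hmod A)
    (Y : hmod B) (H : X -> Y) : Prop :=
  ((forall x y, H (x + y) = H x + H y) /\
      (forall (l : R[i]) x, H (l *: x) = l *: H x) /\
      (forall x y z, H (hm_act (hm_ip x y) z)
                     = hm_act (hm_ip (H x) (H y)) (H z))).

(* Main.v *)
Require Import Defs.
From HB Require Import structures.
From mathcomp Require Import all_boot all_order all_algebra.
From mathcomp Require Import complex.
From mathcomp Require Import boolp reals.
From mathcomp Require Import ring lra.
Import Order.TTheory GRing.Theory Num.Theory.
Local Open Scope ring_scope.
Local Open Scope complex_scope.

(** The map is [H x = lim 2^-n f (2^n x)] (Hyers' method): the control on [phi]
    makes the sequence geometrically Cauchy and kills all defects in the limit,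
    and additivity together with homogeneity for unimodular scalars gives
    complex linearity.

    The module norm is only given by [sqrt |<x, x>|], and a positive element of a
    C*-algebra only as some [b^* b]. The triangle inequality follows from
    Cauchy-Schwarz, which is reduced to [|b^* b| <= |b^* b + d^* d|]. The latter
    is proved for bounded adjointable operators on the algebra, among which there
    is an identity even if the algebra has no unit: the cone of self-adjoint [T]
    with [|t - T| <= t] for some [t] is visibly closed under sums, its elements
    have square roots in their bicommutants, and Kaplansky's argument shows that
    it contains all [B^* B]. *)

Set Implicit Arguments. Unset Strict Implicit. Unset Printing Implicit Defensive.

(** * Real sequences with limit superior at most 0 *)

Section NullSequences.
Variable R : realType.
Implicit Types u v : nat -> R.

(** One-sided, without absolute value: these sequences bound norms from above, and negative terms do
    no harm. *)
Definition null_seq u := forall e : R, 0 < e ->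
  exists N : nat, forall n : nat, (N <= n)%N -> u n < e.

Lemma null_seq_le u v : (forall n, u n <= v n) -> null_seq v -> null_seq u.
Proof.
move=> uv v0 e e0; have [N HN] := v0 e e0.
by exists N => n Nn; apply: le_lt_trans (uv n) (HN n Nn).
Qed.

Lemma null_seqZ (c : R) u : 0 <= c -> null_seq u -> null_seq (fun n => c * u n).
Proof.
move=> c0 u0 e e0; have c1 : 0 < c + 1 by lra.
have [N HN] := u0 (e / (c + 1)) (divr_gt0 e0 c1).
exists N => n /HN; rewrite ltr_pdivlMr // => un.
have [u1|u1] := leP 0 (u n); last by apply: le_lt_trans e0; nra.
by nra.
Qed.

Lemma null_seq_const_le0 (c : R) : null_seq (fun=> c) -> c <= 0.
Proof.
move=> c0; rewrite leNgt; apply/negP => cp.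
by have [N /(_ N (leqnn N))] := c0 c cp; rewrite ltxx.
Qed.

Lemma null_seq_inv : null_seq (fun n => (n.+1%:R)^-1).
Proof.
move=> e e0; exists (Num.Def.archi_bound e^-1) => n Nn.
have ei : 0 < e^-1 by rewrite invr_gt0.
have h1 : e^-1 < n.+1%:R.
  apply: lt_le_trans (archi_boundP (ltW ei)) _.
  by rewrite ler_nat (leq_trans Nn).
by rewrite -(invrK e) ltf_pV2 ?posrE.
Qed.

Lemma null_seq_expr (q : R) : 0 <= q -> q < 1 -> null_seq (fun n => q ^+ n).
Proof.
rewrite le_eqVlt => /orP[/eqP<- _|q0 q1].
  by move=> e e0; exists 1%N => -[//|n] _; rewrite expr0n.
have qi : 1 < q^-1 by rewrite invf_gt1.
pose d := q^-1 - 1; have d0 : 0 < d by rewrite subr_gt0.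
(* Bernoulli's inequality for q^-1 = 1 + d; capping d at 1 allows the factor n + 1 in place of n, so
   that [null_seq_inv] applies. *)
have bern n : n.+1%:R * Num.min d 1 <= q^-1 ^+ n.
  elim: n => [|n IH]; first by rewrite mul1r expr0 ge_min lexx orbT.
  have -> : q^-1 ^+ n.+1 = q^-1 ^+ n + d * q^-1 ^+ n.
    by rewrite exprS /d mulrBl mul1r addrC subrK.
  have m1 : Num.min d 1 <= d by rewrite ge_min lexx.
  have e1 : 1 <= q^-1 ^+ n by rewrite exprn_ege1 // ltW.
  rewrite -[n.+2]addn1 natrD mulrDl mul1r lerD //.
  by apply: le_trans m1 _; rewrite ler_peMr // ltW.
have m0 : 0 < Num.min d 1 by rewrite lt_min d0 ltr01.
apply: null_seq_le (null_seqZ (ltW (_ : 0 < (Num.min d 1)^-1)) null_seq_inv).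
  move=> n; rewrite -invfM -[q ^+ n]invrK lef_pV2 ?posrE ?invr_gt0 ?exprn_gt0 //.
    by rewrite mulrC -exprVn.
  by rewrite mulr_gt0.
by rewrite invr_gt0.
Qed.

End NullSequences.

(** * The modulus of complex numbers *)

Section ComplexModulus.
Variable R : realType.
Implicit Types (z : R[i]) (t : R).

Lemma cabs_real t : cabs t%:C = `|t|.
Proof. by rewrite /cabs /= expr0n addr0 sqrtr_sqr. Qed.

Lemma cabs_conj z : cabs (conjc z) = cabs z.
Proof. by case: z => a b; rewrite /= sqrrN. Qed.

Lemma cabs_i : cabs ('i%C : R[i]) = 1.
Proof. by rewrite /= expr0n add0r expr1n sqrtr1. Qed.

Lemma cabs_ge0 z : 0 <= cabs z.
Proof. by case: z => a b; rewrite sqrtr_ge0. Qed.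

End ComplexModulus.

(** * Norms on complex vector spaces, and completeness with a rate *)

Section Norms.
Variables (R : realType) (V : lmodType R[i]).
Implicit Types (N : V -> R).

Definition is_norm N := [/\ forall x, 0 <= N x, forall x, N x = 0 -> x = 0,
  forall x y, N (x + y) <= N x + N y & forall l x, N (l *: x) = cabs l * N x].

Variable N : V -> R.
Hypothesis Nn : is_norm N.

Lemma norm_ge0 x : 0 <= N x. Proof. by case: Nn. Qed.
Lemma norm0_eq0 x : N x = 0 -> x = 0. Proof. by case: Nn => _ + _ _; apply. Qed.
Lemma norm_triangle x y : N (x + y) <= N x + N y. Proof. by case: Nn. Qed.
Lemma norm_scale l x : N (l *: x) = cabs l * N x. Proof. by case: Nn. Qed.

Lemma norm_real_scale (t : R) x : N (t%:C *: x) = `|t| * N x.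
Proof. by rewrite norm_scale cabs_real. Qed.

Lemma norm_zero : N 0 = 0.
Proof. by rewrite -(scale0r 0) -(rmorph0 (real_complex R)) norm_real_scale normr0 mul0r. Qed.

Lemma norm_opp x : N (- x) = N x.
Proof.
have -> : - x = (-1)%:C *: x by rewrite rmorphN1 scaleN1r.
by rewrite norm_real_scale normrN1 mul1r.
Qed.

Lemma norm_distC x y : N (x - y) = N (y - x).
Proof. by rewrite -norm_opp opprB. Qed.

Lemma norm_dist_triangle z x y : N (x - y) <= N (x - z) + N (z - y).
Proof. by apply: le_trans (norm_triangle _ _); rewrite addrA subrK. Qed.

Lemma norm_le0_eq0 x : N x <= 0 -> x = 0.
Proof. by move=> x0; apply: norm0_eq0; apply/le_anti; rewrite x0 norm_ge0. Qed.

Lemma norm_null_eq x y (b : nat -> R) :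
  null_seq b -> (forall n, N (x - y) <= b n) -> x = y.
Proof.
move=> b0 xyb; apply/subr0_eq/norm_le0_eq0/null_seq_const_le0.
exact: null_seq_le xyb b0.
Qed.

(** The limit inherits the rate: let m tend to infinity in the Cauchy estimate. Later limits are
    handled through such explicit rates. *)
Lemma complete_rate (u : nat -> V) (b : nat -> R) : complete_wrt N ->
  null_seq b -> (forall n m, (n <= m)%N -> N (u n - u m) <= b n) ->
  exists l, forall n, N (u n - l) <= b n.
Proof.
move=> Nc b0 ub; case: (Nc u) => [e e0|l ul].
  have e2 : 0 < e / 2 by lra.
  have [K HK] := b0 _ e2; exists K => m n Km Kn.
  have := norm_dist_triangle (u K) (u m) (u n).
  have := ub _ _ Km; have := ub _ _ Kn; rewrite (norm_distC (u m) (u K)).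
  by have := HK K (leqnn K); lra.
exists l => n; rewrite -subr_le0; apply: null_seq_const_le0 => e e0.
have [K HK] := ul e e0; exists 0%N => _ _ /=.
have := HK _ (leq_maxl K n); have := ub _ _ (leq_maxr K n).
by have := norm_dist_triangle (u (maxn K n)) (u n) l; lra.
Qed.

End Norms.

(** * Algebraic rules and the norm in a C*-algebra *)

Section CStarAlgebra.
Variables (R : realType) (A : cstar_alg R).
Implicit Types (a b c : A) (l : R[i]).

Let ax := ca_ax A.

Lemma ca_mulA a b c : ca_mul a (ca_mul b c) = ca_mul (ca_mul a b) c.
Proof. by move: ax => -[]. Qed.
Lemma ca_mulDl a b c : ca_mul (a + b) c = ca_mul a c + ca_mul b c.
Proof. by move: ax => -[_ []]. Qed.
Lemma ca_mulDr a b c : ca_mul a (b + c) = ca_mul a b + ca_mul a c.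
Proof. by move: ax => -[_ [_ []]]. Qed.
Lemma ca_mulZl l a b : ca_mul (l *: a) b = l *: ca_mul a b.
Proof. by move: ax => -[_ [_ [_ [/(_ l a b)[]]]]]. Qed.
Lemma ca_mulZr l a b : ca_mul a (l *: b) = l *: ca_mul a b.
Proof. by move: ax => -[_ [_ [_ [/(_ l a b)[]]]]]. Qed.
Lemma ca_starD a b : ca_star (a + b) = ca_star a + ca_star b.
Proof. by move: ax => -[_ [_ [_ [_ []]]]]. Qed.
Lemma ca_starZ l a : ca_star (l *: a) = conjc l *: ca_star a.
Proof. by move: ax => -[_ [_ [_ [_ [_ []]]]]]. Qed.
Lemma ca_starK a : ca_star (ca_star a) = a.
Proof. by move: ax => -[_ [_ [_ [_ [_ [_ []]]]]]]. Qed.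
Lemma ca_starM a b : ca_star (ca_mul a b) = ca_mul (ca_star b) (ca_star a).
Proof. by move: ax => -[_ [_ [_ [_ [_ [_ [_ []]]]]]]]. Qed.

Lemma ca_is_norm : is_norm (@ca_norm _ A).
Proof. by move: ax => -[_ [_ [_ [_ [_ [_ [_ [_ [? [? [? [? _]]]]]]]]]]]]; split. Qed.
Lemma ca_normM a b : ca_norm (ca_mul a b) <= ca_norm a * ca_norm b.
Proof. by move: ax => -[_ [_ [_ [_ [_ [_ [_ [_ [_ [_ [_ [_ []]]]]]]]]]]]]. Qed.
Lemma ca_norm_starM a : ca_norm (ca_mul (ca_star a) a) = ca_norm a ^+ 2.
Proof. by move: ax => -[_ [_ [_ [_ [_ [_ [_ [_ [_ [_ [_ [_ [_ []]]]]]]]]]]]]]. Qed.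
Lemma ca_complete : complete_wrt (@ca_norm _ A).
Proof. by case: ax => [_ [_ [_ [_ [_ [_ [_ [_ [_ [_ [_ [_ [_ [_ ?]]]]]]]]]]]]]]. Qed.

Lemma ca_norm_ge0 a : 0 <= ca_norm a.
Proof. exact: norm_ge0 ca_is_norm a. Qed.

Lemma ca_mulN a b : ca_mul (- a) b = - ca_mul a b.
Proof. by rewrite -scaleN1r ca_mulZl scaleN1r. Qed.
Lemma ca_mulrN a b : ca_mul a (- b) = - ca_mul a b.
Proof. by rewrite -scaleN1r ca_mulZr scaleN1r. Qed.
Lemma ca_starN a : ca_star (- a) = - ca_star a.
Proof. by rewrite -scaleN1r ca_starZ rmorphN1 scaleN1r. Qed.

(** Cancel |b| in |b|^2 = |b^* b| <= |b^*| |b|, then exchange b and b^*. *)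
Lemma ca_norm_star a : ca_norm (ca_star a) = ca_norm a.
Proof.
have le b : ca_norm b <= ca_norm (ca_star b).
  have := ca_normM (ca_star b) b; rewrite ca_norm_starM expr2.
  by have := ca_norm_ge0 b; rewrite le_eqVlt => /orP[/eqP <- _|b0]; rewrite ?ca_norm_ge0 ?ler_pM2r.
by apply/le_anti; rewrite le andbT; have := le (ca_star a); rewrite ca_starK.
Qed.

(** There may be no unit to test on; c = a - b serves instead, by the C*-identity. *)
Lemma ca_starM_inj a b :
  (forall c, ca_mul (ca_star a) c = ca_mul (ca_star b) c) -> a = b.
Proof.
move=> ab; apply/subr0_eq/(norm0_eq0 ca_is_norm)/eqP.
rewrite -sqrf_eq0 -ca_norm_starM ca_starD ca_starN ca_mulDl ab ca_mulN subrr.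
by rewrite (norm_zero ca_is_norm).
Qed.

Lemma ca_starM_injr a b :
  (forall c, ca_mul (ca_star c) a = ca_mul (ca_star c) b) -> a = b.
Proof.
move=> ab; apply: ca_starM_inj => c.
by apply: (can_inj ca_starK); rewrite !ca_starM !ca_starK.
Qed.

End CStarAlgebra.

#[global] Hint Extern 0 (is_true (0 <= ca_norm _)) => exact: ca_norm_ge0 : core.

(** * The ring of adjointable operators on the algebra *)

(** The algebra is viewed as a Hilbert module over itself with pairing a^* b, so these are its
    multipliers. Linearity is derived from the adjoint relation in [opD] and [opZ]. *)
Record adjop (R : realType) (A : cstar_alg R) := AdjOp {
  opf :> A -> A;
  opa : A -> A;
  opP : forall a b, ca_mul (ca_star (opf a)) b = ca_mul (ca_star a) (opa b);
  op_bounded : exists c, forall a, ca_norm (opf a) <= c * ca_norm a }.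

HB.instance Definition _ (R : realType) (A : cstar_alg R) :=
  gen_eqMixin (adjop A).
HB.instance Definition _ (R : realType) (A : cstar_alg R) :=
  gen_choiceMixin (adjop A).

Section AdjointableOperators.
Variables (R : realType) (A : cstar_alg R).
Implicit Types (T S : adjop A) (a b : A) (l : R[i]) (c t : R).

Lemma opa_adj T a b : ca_mul (ca_star (opa T a)) b = ca_mul (ca_star a) (T b).
Proof.
apply: (can_inj (@ca_starK _ A)); rewrite !ca_starM !ca_starK; exact/esym/opP.
Qed.

(** The adjoint is determined by the map, and the remaining fields are propositions. *)
Lemma adjop_ext T S : T =1 S -> T = S.
Proof.
move=> TS; have aTS : opa T =1 opa S.
  by move=> a; apply: ca_starM_injr => c; rewrite -!opP TS.
case: T S TS aTS => [f g fP fB] [f' g' fP' fB'] /= /funext ff /funext gg.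
by rewrite -{}ff -{}gg in fP' fB' *; congr AdjOp; apply: Prop_irrelevance.
Qed.

Lemma opD T a b : T (a + b) = T a + T b.
Proof. by apply: ca_starM_inj => c; rewrite opP !ca_starD !ca_mulDl !opP. Qed.

Lemma opZ T l a : T (l *: a) = l *: T a.
Proof. by apply: ca_starM_inj => c; rewrite opP !ca_starZ !ca_mulZl !opP. Qed.

(** Working with upper bounds avoids defining the operator norm as a supremum. *)
Definition op_le T c := forall a, ca_norm (T a) <= c * ca_norm a.

Lemma op_le_exists T : exists2 c, 0 < c & op_le T c.
Proof.
have [c cT] := op_bounded T; exists (Num.max c 1).
  by rewrite lt_max ltr01 orbT.
by move=> a; apply: le_trans (cT a) _; by apply: ler_wpM2r; rewrite ?le_max ?lexx.
Qed.

(** Divide |T^* a|^2 = |a^* T T^* a| <= |a| c |T^* a| by |T^* a|. *)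
Lemma opa_le T c : op_le T c -> forall a, ca_norm (opa T a) <= c * ca_norm a.
Proof.
move=> Tc a; have := ca_norm_ge0 (opa T a); rewrite le_eqVlt => /orP[/eqP z|z].
  by rewrite -z; apply: le_trans (Tc a).
rewrite -(ler_pM2r z) -expr2 -ca_norm_starM opa_adj.
apply: le_trans (ca_normM _ _) _; rewrite ca_norm_star mulrC mulrAC.
exact: ler_wpM2r.
Qed.

Fact opadj_subproof T : exists c, forall a, ca_norm (opa T a) <= c * ca_norm a.
Proof. by have [c /opa_le] := op_bounded T; exists c. Qed.

Definition opadj T := AdjOp (opa_adj T) (opadj_subproof T).

Program Definition op_scalar l : adjop A :=
  @AdjOp R A (fun a => l *: a) (fun a => conjc l *: a) _ _.
Next Obligation. by rewrite ca_starZ ca_mulZl ca_mulZr. Qed.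
Next Obligation. by exists (cabs l) => a; rewrite (norm_scale (ca_is_norm A)). Qed.

Program Definition op_add T S : adjop A :=
  @AdjOp R A (fun a => T a + S a) (fun a => opa T a + opa S a) _ _.
Next Obligation. by rewrite ca_starD ca_mulDl ca_mulDr !opP. Qed.
Next Obligation.
have [[c Tc] [d Sd]] := (op_bounded T, op_bounded S); exists (c + d) => a.
apply: le_trans (norm_triangle (ca_is_norm A) _ _) _.
by rewrite mulrDl lerD ?Tc ?Sd.
Qed.

Program Definition op_comp T S : adjop A :=
  @AdjOp R A (fun a => T (S a)) (fun a => opa S (opa T a)) _ _.
Next Obligation. by rewrite !opP. Qed.
Next Obligation.
have [[c c0 Tc] [d d0 Sd]] := (op_le_exists T, op_le_exists S); exists (c * d) => a.
by apply: le_trans (Tc _) _; rewrite -mulrA ler_pM2l.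
Qed.

Program Definition op_opp T : adjop A :=
  @AdjOp R A (fun a => - T a) (fun a => - opa T a) _ _.
Next Obligation. by rewrite ca_starN ca_mulN ca_mulrN opP. Qed.
Next Obligation.
by have [c Tc] := op_bounded T; exists c => a; rewrite (norm_opp (ca_is_norm A)).
Qed.

Program Definition op_lmul a : adjop A :=
  @AdjOp R A (fun b => ca_mul a b) (fun b => ca_mul (ca_star a) b) _ _.
Next Obligation. by rewrite ca_starM ca_mulA. Qed.
Next Obligation. by exists (ca_norm a) => b; apply: ca_normM. Qed.

Program Definition adjop_zmod := @GRing.isZmodule.Build (adjop A) (op_scalar 0) op_opp
  op_add _ _ _ _.
Next Obligation. by move=> x y z; apply: adjop_ext => a /=; rewrite addrA. Qed.
Next Obligation. by move=> x y; apply: adjop_ext => a /=; rewrite addrC. Qed.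
Next Obligation. by move=> x; apply: adjop_ext => a /=; rewrite scale0r add0r. Qed.
Next Obligation. by move=> x; apply: adjop_ext => a /=; rewrite scale0r addNr. Qed.
HB.instance Definition _ := adjop_zmod.

(** This kind of ring allows 1 = 0, which happens when the algebra is zero. *)
Program Definition adjop_ring := @GRing.Zmodule_isPzRing.Build (adjop A)
  (op_scalar 1) op_comp _ _ _ _ _.
Next Obligation. by move=> x y z; apply: adjop_ext. Qed.
Next Obligation. by move=> x; apply: adjop_ext => a /=; rewrite scale1r. Qed.
Next Obligation. by move=> x; apply: adjop_ext => a /=; rewrite scale1r. Qed.
Next Obligation. by move=> x y z; apply: adjop_ext. Qed.
Next Obligation. by move=> x y z; apply: adjop_ext => a /=; rewrite opD. Qed.
HB.instance Definition _ := adjop_ring.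

End AdjointableOperators.

(** * Norm bounds and completeness for adjointable operators *)

Section OperatorBounds.
Variables (R : realType) (A : cstar_alg R).
Implicit Types (T S H K G : adjop A) (a b : A) (l : R[i]) (c d t : R).

Definition op_real t : adjop A := op_scalar A t%:C.

Lemma op_scalarC l T : op_scalar A l * T = T * op_scalar A l.
Proof. by apply: adjop_ext => a /=; rewrite opZ. Qed.

Lemma op_scalarM l m : op_scalar A (l * m) = op_scalar A l * op_scalar A m.
Proof. by apply: adjop_ext => a /=; rewrite scalerA. Qed.

Lemma op_realC t T : op_real t * T = T * op_real t.
Proof. exact: op_scalarC. Qed.

Lemma op_realM t c : op_real (t * c) = op_real t * op_real c.
Proof. by rewrite -op_scalarM -rmorphM. Qed.

Lemma op_realD t c : op_real (t + c) = op_real t + op_real c.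
Proof. by apply: adjop_ext => a /=; rewrite -scalerDl -rmorphD. Qed.

Definition op_i : adjop A := op_scalar A 'i%C.

Lemma op_iC T : op_i * T = T * op_i.
Proof. exact: op_scalarC. Qed.

Lemma op_i_mulM S T : op_i * S * (op_i * T) = - (S * T).
Proof.
rewrite -mulrA (mulrA S) -op_iC !mulrA -op_scalarM.
have -> : 'i%C * 'i%C = - 1 :> R[i] by rewrite -expr2 sqr_i.
by apply: adjop_ext => a /=; rewrite scaleN1r.
Qed.

Lemma opadj_i : opadj op_i = - op_i.
Proof.
apply: adjop_ext => a /=; rewrite -scaleNr; congr (_ *: _).
by apply/eqP; rewrite eq_complex /= oppr0 !eqxx.
Qed.

Lemma op_real1 : op_real 1 = 1. Proof. by []. Qed.
Lemma op_real0 : op_real 0 = 0. Proof. by []. Qed.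

Lemma op_real_half T : op_real 2^-1 * (T + T) = T.
Proof.
rewrite -[X in X + X]mul1r -mulrDl mulrA -op_real1.
by rewrite -op_realD -op_realM mulVf ?op_real1 ?mul1r // pnatr_eq0.
Qed.

Lemma opadjK T : opadj (opadj T) = T. Proof. exact: adjop_ext. Qed.

Lemma opadjD T S : opadj (T + S) = opadj T + opadj S.
Proof. exact: adjop_ext. Qed.
Lemma opadjN T : opadj (- T) = - opadj T.
Proof. exact: adjop_ext. Qed.
Lemma opadjM T S : opadj (T * S) = opadj S * opadj T.
Proof. exact: adjop_ext. Qed.
Lemma opadj_scalar l : opadj (op_scalar A l) = op_scalar A (conjc l).
Proof. exact: adjop_ext. Qed.
Lemma opadj_real t : opadj (op_real t) = op_real t.
Proof. by rewrite opadj_scalar conjc_real. Qed.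
Lemma opadj1 : opadj 1 = 1 :> adjop A.
Proof. exact: opadj_real 1. Qed.

Lemma op_leD T S c d : op_le T c -> op_le S d -> op_le (T + S) (c + d).
Proof.
move=> Tc Sd a; apply: le_trans (norm_triangle (ca_is_norm A) _ _) _.
by rewrite mulrDl lerD ?Tc ?Sd.
Qed.

Lemma op_leN T c : op_le T c -> op_le (- T) c.
Proof. by move=> Tc a; rewrite (norm_opp (ca_is_norm A)). Qed.

Lemma op_leM T S c d : 0 <= c -> op_le T c -> op_le S d -> op_le (T * S) (c * d).
Proof.
by move=> c0 Tc Sd a; apply: le_trans (Tc _) _; rewrite -mulrA ler_wpM2l.
Qed.

Lemma op_le_real t : 0 <= t -> op_le (op_real t) t.
Proof. by move=> t0 a; rewrite (norm_real_scale (ca_is_norm A)) ger0_norm. Qed.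

Lemma op_le_realM t T c : 0 <= t -> op_le T c -> op_le (op_real t * T) (t * c).
Proof. by move=> t0; apply: op_leM (op_le_real t0). Qed.

Lemma op_leW T c d : c <= d -> op_le T c -> op_le T d.
Proof.
by move=> cd Tc a; apply: le_trans (Tc a) _; apply: ler_wpM2r.
Qed.

Lemma op_le_adj T c : op_le T c -> op_le (opadj T) c.
Proof. exact: opa_le. Qed.

(** The C*-identity for [T a]: |T a|^2 = |a^* T^* T a| <= c^2 |a|^2. *)
Lemma op_le_cstar T c : 0 <= c -> op_le (opadj T * T) (c ^+ 2) -> op_le T c.
Proof.
move=> c0 Tc a; rewrite -(@ler_pXn2r _ 2) ?nnegrE ?mulr_ge0 //.
rewrite -ca_norm_starM opP exprMn expr2 [X in _ * X]expr2.
apply: le_trans (ca_normM _ _) _; rewrite ca_norm_star -expr2.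
by rewrite mulrCA; apply: ler_wpM2l => //; apply: Tc.
Qed.

Lemma op_le_sa H c : 0 <= c -> opadj H = H -> op_le (H * H) (c ^+ 2) -> op_le H c.
Proof. by move=> c0 Ha HH; apply: op_le_cstar; rewrite ?Ha. Qed.

Lemma op_le_sqrt H c : 0 <= c -> opadj H = H -> op_le (H * H) c ->
  op_le H (Num.sqrt c).
Proof.
by move=> c0 Ha HH; apply: op_le_sa; rewrite ?sqrtr_ge0 ?sqr_sqrtr.
Qed.

Lemma op_le0 T : op_le T 0 -> T = 0.
Proof.
move=> T0; apply: adjop_ext => a /=; rewrite scale0r.
by apply: (norm_le0_eq0 (ca_is_norm A)); rewrite -(mul0r (ca_norm a)).
Qed.

Lemma op_null_eq T S (b : nat -> R) :
  null_seq b -> (forall n, op_le (T - S) (b n)) -> T = S.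
Proof.
move=> b0 TS; apply: adjop_ext => a.
apply: (norm_null_eq (ca_is_norm A) (null_seqZ (ca_norm_ge0 a) b0)) => n.
by rewrite mulrC; apply: TS.
Qed.

(** Limits are taken pointwise, both for the operators and for their adjoints, which are Cauchy at
    the same rate; the adjoint relation then passes to the limit. *)
Lemma op_complete (T_ : nat -> adjop A) (b : nat -> R) : null_seq b ->
  (forall n m, (n <= m)%N -> op_le (T_ n - T_ m) (b n)) ->
  exists T, forall n, op_le (T_ n - T) (b n).
Proof.
move=> b0 Tb; have nA := ca_is_norm A.
have lim (S_ : nat -> adjop A) :
    (forall n m, (n <= m)%N -> op_le (S_ n - S_ m) (b n)) ->
    exists s : A -> A, forall a n, ca_norm (S_ n a - s a) <= b n * ca_norm a.
  move=> Sb; suff /choice[s sP] : forall a, exists l : A,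
      forall n, ca_norm (S_ n a - l) <= b n * ca_norm a by exists s.
  move=> a; apply: (complete_rate nA (@ca_complete _ A)).
    by apply: null_seq_le (null_seqZ (ca_norm_ge0 a) b0) => n; rewrite mulrC.
  by move=> n m nm; apply: Sb.
have [t tP] := lim _ Tb.
have [|s sP] := lim (fun n => opadj (T_ n)).
  by move=> n m nm; rewrite -opadjN -opadjD; apply/op_le_adj/Tb.
have tsP a (c : A) : ca_mul (ca_star (t a)) c = ca_mul (ca_star a) (s c).
  apply: (norm_null_eq nA (null_seqZ (_ : 0 <= 2 * (ca_norm a * ca_norm c)) b0)).
    by rewrite !mulr_ge0.
  move=> n.
  have -> : ca_mul (ca_star (t a)) c - ca_mul (ca_star a) (s c) =
      ca_mul (ca_star (t a - T_ n a)) c + ca_mul (ca_star a) (opa (T_ n) c - s c).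
    rewrite ca_starD ca_starN ca_mulDl ca_mulDr ca_mulN ca_mulrN opP.
    by rewrite addrA subrK.
  apply: le_trans (norm_triangle nA _ _) _.
  have := ca_normM (ca_star (t a - T_ n a)) c.
  have := ca_normM (ca_star a) (opa (T_ n) c - s c).
  rewrite !ca_norm_star (norm_distC nA (t a)) => h1 h2.
  have := ler_wpM2r (ca_norm_ge0 c) (tP a n).
  by have := ler_wpM2l (ca_norm_ge0 a) (sP c n); simpl in *; lra.
have tB : exists c, forall a, ca_norm (t a) <= c * ca_norm a.
  have [c c0 cP] := op_le_exists (T_ 0%N); exists (b 0%N + c) => a.
  have := norm_triangle nA (t a - T_ 0%N a) (T_ 0%N a).
  by rewrite subrK (norm_distC nA) mulrDl; have := tP a 0%N; have := cP a; lra.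
by exists (AdjOp tsP tB) => n a; apply: tP.
Qed.

(** [H] is the real part of T = H + i K, and T^* T = H^2 + K^2 because [H] and [K] commute; so a
    bound for T bounds [H]. *)
Lemma commuting_sa_le H K c : 0 <= c -> opadj H = H -> opadj K = K ->
  H * K = K * H -> op_le (H * H + K * K) (c ^+ 2) -> op_le H c.
Proof.
move=> c0 Ha Ka HK le_c.
pose T := H + op_i * K; have Ta : opadj T = H - op_i * K.
  by rewrite opadjD opadjM opadj_i Ha Ka mulrN op_iC.
have TT : opadj T * T = H * H + K * K.
  have HiK : H * (op_i * K) = op_i * K * H by rewrite mulrA -(op_iC H) -!mulrA HK.
  by rewrite Ta mulrDl !mulrDr !mulNr HiK op_i_mulM opprK addrA addrK.
have Tc : op_le T c by apply: op_le_cstar => //; rewrite TT.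
have -> : H = op_real 2^-1 * (T + opadj T).
  by rewrite Ta addrACA subrr addr0 op_real_half.
apply: (@op_leW _ (2^-1 * (c + c))); first by lra.
by apply: op_le_realM; [lra|apply: op_leD => //; apply: op_le_adj].
Qed.

End OperatorBounds.

(** * Square roots of 1 - G for self-adjoint contractions G *)

Section OperatorSquareRoot.
Variables (R : realType) (A : cstar_alg R).
Implicit Types (T S H K G : adjop A) (a b : A) (c d t s : R).
Local Notation rs := (@op_real R A).

(* Iterating [y := (g + y^2) / 2] from 0 converges to [1 - sqrt (1 - g)];
   [sqrt_rate] is the scalar case [g = 1], which dominates the operator case. *)
Fixpoint sqrt_rate n : R :=
  if n is m.+1 then 2^-1 * (1 + sqrt_rate m ^+ 2) else 0.

Lemma sqrt_rate_bounds n : 0 <= sqrt_rate n <= 1.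
Proof. by elim: n => [|n /andP[h0 h1]] /=; [rewrite lexx ler01|apply/andP; split; nra]. Qed.

Lemma sqrt_rate_ge0 n : 0 <= sqrt_rate n.
Proof. by case/andP: (sqrt_rate_bounds n). Qed.

Lemma sqrt_rate_le1 n : sqrt_rate n <= 1.
Proof. by case/andP: (sqrt_rate_bounds n). Qed.

(** The error e = 1 - [sqrt_rate n] evolves by e -> e - e^2 / 2, which keeps it below 2 / (n +
    2). *)
Lemma sqrt_rate_null : null_seq (fun n => 1 - sqrt_rate n).
Proof.
suff rate n : 1 - sqrt_rate n <= 2 * (n.+2%:R)^-1.
  apply: null_seq_le (null_seqZ (_ : 0 <= 2) (@null_seq_inv R)) => [n|]; last by lra.
  apply: le_trans (rate n) _; rewrite ler_pM2l ?ltr0n // lef_pV2 ?posrE ?ltr0n //.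
  by rewrite ler_nat.
elim: n => [|n IH]; first by rewrite subr0 divff ?pnatr_eq0.
have /andP[h0 h1] := sqrt_rate_bounds n.
rewrite -(natr1 n.+2) /=.
have k2 : 2 <= n.+2%:R :> R by rewrite ler_nat.
move: (n.+2%:R) k2 IH => k k2; move: (sqrt_rate n) h0 h1 => x h0 h1 IH.
have k0 : 0 < k by lra.
have kV : k * k^-1 = 1 by rewrite divff // gt_eqF.
rewrite ler_pdivlMr; last by lra.
have y0 : 0 < k^-1 by rewrite invr_gt0.
have y1 : k^-1 <= 2^-1 by rewrite lef_pV2 ?posrE //; lra.
(* Since e - e^2 / 2 increases on [0, 1], it may be evaluated at the upper bound e = 2 / k. *)
have h2 : 1 - 2^-1 * (1 + x ^+ 2) <= 2 * k^-1 - 2 * k^-1 ^+ 2 by nra.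
apply: le_trans (ler_wpM2r (_ : 0 <= k + 1) h2) _; first by lra.
have -> : (2 * k^-1 - 2 * k^-1 ^+ 2) * (k + 1) =
   2 * (k * k^-1) + 2 * k^-1 - 2 * (k * k^-1) * k^-1 - 2 * k^-1 ^+ 2 by ring.
by rewrite kV; nra.
Qed.

Fixpoint sqrt_iter G n : adjop A :=
  if n is m.+1 then rs 2^-1 * (G + sqrt_iter G m * sqrt_iter G m) else 0.

Lemma sqrt_iter_le G n : op_le G 1 -> op_le (sqrt_iter G n) (sqrt_rate n).
Proof.
move=> G1; elim: n => [|n IH] /=; first exact: op_le_real.
apply: op_le_realM; first by lra.
by apply: op_leD => //; rewrite expr2; apply: op_leM => //; apply: sqrt_rate_ge0.
Qed.

(** The identity y'^2 - y^2 = y' (y' - y) + (y' - y) y holds without commutativity. It gives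
    operators and scalars the same recursion for differences, so the bounds propagate term by
    term. *)
Lemma sqrt_iter_step G n : op_le G 1 ->
  op_le (sqrt_iter G n.+1 - sqrt_iter G n) (sqrt_rate n.+1 - sqrt_rate n).
Proof.
move=> G1; elim: n => [|n IH].
  by rewrite /= !subr0 mulr0 addr0 expr0n addr0; apply: op_le_realM => //; lra.
have b0 m := sqrt_rate_ge0 m; have bP m := sqrt_iter_le m G1.
have -> : sqrt_iter G n.+2 - sqrt_iter G n.+1 = rs 2^-1 *
    (sqrt_iter G n.+1 * (sqrt_iter G n.+1 - sqrt_iter G n) +
     (sqrt_iter G n.+1 - sqrt_iter G n) * sqrt_iter G n).
  rewrite {1}[sqrt_iter G n.+2]/= {4}[sqrt_iter G n.+1]/= -mulrBr; congr (_ * _).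
  by rewrite mulrBr mulrBl addrA subrK addrAC opprD addrA subrr add0r addrC.
have -> : sqrt_rate n.+2 - sqrt_rate n.+1 = 2^-1 *
    (sqrt_rate n.+1 * (sqrt_rate n.+1 - sqrt_rate n) +
     (sqrt_rate n.+1 - sqrt_rate n) * sqrt_rate n).
  have e1 : sqrt_rate n.+1 = 2^-1 * (1 + sqrt_rate n ^+ 2) by [].
  have e2 : sqrt_rate n.+2 = 2^-1 * (1 + sqrt_rate n.+1 ^+ 2) by [].
  by move: (sqrt_rate n.+2) (sqrt_rate n.+1) e1 e2 => ? ? ? ?; lra.
have d0 : 0 <= sqrt_rate n.+1 - sqrt_rate n.
  by rewrite /=; have := b0 n; have := sqrt_rate_le1 n; nra.
apply: op_le_realM; first by lra.
by apply: op_leD; apply: op_leM.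
Qed.

Lemma sqrt_iter_cauchy G n m : op_le G 1 -> (n <= m)%N ->
  op_le (sqrt_iter G n - sqrt_iter G m) (1 - sqrt_rate n).
Proof.
move=> G1 nm.
apply: (@op_leW _ _ _ (sqrt_rate m - sqrt_rate n)).
  by have := sqrt_rate_le1 m; lra.
rewrite -opprB; apply: op_leN; elim: m nm => [|m IH].
  by rewrite leqn0 => /eqP->; rewrite !subrr; apply: op_le_real.
rewrite leq_eqVlt => /orP[/eqP->|/IH h]; first by rewrite !subrr; apply: op_le_real.
have := op_leD (sqrt_iter_step m G1) h.
by rewrite !addrA !subrK.
Qed.

Lemma sqrt_iter_sa G n : opadj G = G -> opadj (sqrt_iter G n) = sqrt_iter G n.
Proof.
move=> Ga; elim: n => [|n IH] /=; first exact: (opadj_real A 0).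
by rewrite opadjM opadjD opadjM opadj_real Ga IH op_realC.
Qed.

(** The iterates are polynomials in [G]. *)
Lemma sqrt_iter_comm G S n : S * G = G * S ->
  S * sqrt_iter G n = sqrt_iter G n * S.
Proof.
move=> SG; elim: n => [|n IH] /=; first by rewrite mulr0 mul0r.
by rewrite mulrA -op_realC -!mulrA mulrDr mulrDl SG mulrA IH -!mulrA IH.
Qed.

(** The limit of the iteration is a fixed point, Y = (G + Y^2) / 2, which rearranges to (1 - Y)^2 =
    1 - G; the other properties pass from the iterates to the limit. *)
Lemma op_sqrt_contraction G : opadj G = G -> op_le G 1 -> exists Y,
  [/\ opadj Y = Y, op_le Y 1, (1 - Y) * (1 - Y) = 1 - G &
      forall S, S * G = G * S -> S * Y = Y * S].
Proof.
move=> Ga G1.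
have [Y YP] := op_complete sqrt_rate_null (fun n m => sqrt_iter_cauchy G1).
have b0 n : 0 <= 1 - sqrt_rate n by have := sqrt_rate_le1 n; lra.
have YP' n : op_le (Y - sqrt_iter G n) (1 - sqrt_rate n).
  by rewrite -opprB; apply: op_leN.
have null c : 0 <= c -> null_seq (fun n => c * (1 - sqrt_rate n)).
  by move=> c0; apply: null_seqZ sqrt_rate_null.
(* At n = 0 the iterate and [sqrt_rate] are both 0. *)
have Y1 : op_le Y 1 by have := YP' 0%N; rewrite /= !subr0.
have Y2 : Y = rs 2^-1 * (G + Y * Y).
  apply: (op_null_eq (null 2 _)) => [//|n].
  have -> : Y - rs 2^-1 * (G + Y * Y) = (Y - sqrt_iter G n.+1) +
     rs 2^-1 * (sqrt_iter G n * (sqrt_iter G n - Y) + (sqrt_iter G n - Y) * Y).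
    have split3 (g u v : adjop A) : - (rs 2^-1 * (g + v)) =
        - (rs 2^-1 * (g + u)) + rs 2^-1 * (u - v).
      by rewrite -!mulrN -mulrDr !opprD -addrA addKr.
    by rewrite mulrBr mulrBl addrA subrK /= -addrA -split3.
  have step : sqrt_rate n <= sqrt_rate n.+1.
    by rewrite /=; have := sqrt_rate_bounds n => /andP[? ?]; nra.
  (* As [sqrt_rate] increases, this sum is at most 2 (1 - [sqrt_rate n]). *)
  apply: (@op_leW _ _ _ (1 - sqrt_rate n.+1 +
     2^-1 * (1 * (1 - sqrt_rate n) + (1 - sqrt_rate n) * 1))); first by lra.
  apply: op_leD => //; apply: op_le_realM; first by lra.
  apply: op_leD; apply: op_leM => //.
  exact: op_leW (sqrt_rate_le1 n) (sqrt_iter_le n G1).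
exists Y; split=> //.
- apply: (op_null_eq (null 2 _)) => [//|n].
  have -> : opadj Y - Y = opadj (Y - sqrt_iter G n) + (sqrt_iter G n - Y).
    by rewrite opadjD opadjN sqrt_iter_sa // addrA subrK.
  rewrite mulr_natl mulr2n; apply: op_leD => //; exact: op_le_adj.
- have YY : Y + Y = G + Y * Y by rewrite {1 2}Y2 -mulrDr op_real_half.
  rewrite mulrBl mul1r mulrBr mulr1 opprB addrC addrACA -opprD YY opprD.
  by rewrite [Y * Y + 1]addrC addrACA subrr addr0.
- move=> S SG; have [c c0 cP] := op_le_exists S.
  apply: (op_null_eq (null (2 * c) _)) => [|n]; first by lra.
  have -> : S * Y - Y * S = S * (Y - sqrt_iter G n) + (sqrt_iter G n - Y) * S.
    by rewrite mulrBr mulrBl (sqrt_iter_comm n SG) addrA subrK.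
  have -> : 2 * c * (1 - sqrt_rate n) =
    c * (1 - sqrt_rate n) + (1 - sqrt_rate n) * c by ring.
  by apply: op_leD; apply: op_leM => //; apply: ltW.
Qed.

End OperatorSquareRoot.

(** * The cone of positive operators and Kaplansky's argument *)

Section PositiveCone.
Variables (R : realType) (A : cstar_alg R).
Implicit Types (T S H K B C : adjop A) (a b : A) (c d t s : R).
Local Notation rs := (@op_real R A).

(** For self-adjoint [T] the bound confines the spectrum to [0, 2 t], so this is positivity without
    spectral theory. *)
Definition op_pos T := opadj T = T /\ exists2 t, 0 <= t & op_le (rs t - T) t.

Lemma op_real_mulM t c S T : rs t * S * (rs c * T) = rs (t * c) * (S * T).
Proof. by rewrite -mulrA (mulrA S) -op_realC -mulrA mulrA op_realM mulrA. Qed.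

Lemma op_pos_gt0 T : op_pos T -> exists2 t, 0 < t & op_le (rs t - T) t.
Proof.
case=> _ [t t0 Tt]; exists (t + 1); first by lra.
rewrite op_realD addrAC; apply: op_leD => //; exact: op_le_real.
Qed.

Lemma op_pos_sa T : op_pos T -> opadj T = T. Proof. by case. Qed.

Lemma op_posD T S : op_pos T -> op_pos S -> op_pos (T + S).
Proof.
case=> Ta [t t0 Tt] [Sa [s s0 Ss]]; split; first by rewrite opadjD Ta Sa.
exists (t + s); first by lra.
by rewrite op_realD opprD addrACA; apply: op_leD.
Qed.

Lemma op_posZ c T : 0 <= c -> op_pos T -> op_pos (rs c * T).
Proof.
move=> c0 [Ta [t t0 Tt]]; split; first by rewrite opadjM opadj_real Ta op_realC.
exists (c * t); first exact: mulr_ge0.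
by rewrite op_realM -mulrBr; apply: op_le_realM.
Qed.

(** Here G = 1 - H / t is a contraction, and (1 - Y)^2 = 1 - G makes U = sqrt t (1 - Y) a root of
    [H]. It is positive because sqrt t - U = sqrt t Y and Y is a contraction. *)
Lemma op_pos_sqrt H : op_pos H -> exists U,
  [/\ opadj U = U, U * U = H, op_pos U & forall S, S * H = H * S -> S * U = U * S].
Proof.
move=> Hp; have [Ha _] := Hp; have [t t0 Ht] := op_pos_gt0 Hp.
have tV : rs t * rs t^-1 = 1 by rewrite -op_realM divff ?gt_eqF.
have tV0 : 0 <= t^-1 by rewrite invr_ge0 ltW.
pose G := 1 - rs t^-1 * H.
have Ga : opadj G = G by rewrite opadjD opadjN opadj1 opadjM opadj_real Ha -op_realC.
have G1 : op_le G 1.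
  have -> : G = rs t^-1 * (rs t - H) by rewrite mulrBr -op_realC tV.
  have -> : 1 = t^-1 * t by rewrite mulVf ?gt_eqF.
  exact: op_le_realM.
have [Y [Ya Y1 YG Yc]] := op_sqrt_contraction Ga G1.
have st0 := sqrtr_ge0 t.
have Ua : opadj (rs (Num.sqrt t) * (1 - Y)) = rs (Num.sqrt t) * (1 - Y).
  by rewrite opadjM opadjD opadjN opadj1 opadj_real Ya op_realC.
exists (rs (Num.sqrt t) * (1 - Y)); split=> //.
- by rewrite op_real_mulM YG -expr2 sqr_sqrtr ?ltW // /G subKr mulrA tV mul1r.
- split=> //; exists (Num.sqrt t) => //.
  by rewrite mulrBr mulr1 subKr -[X in op_le _ X]mulr1; apply: op_le_realM.
- move=> S SH; rewrite mulrA -op_realC -!mulrA mulrBr mulrBl mulr1 mul1r Yc //.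
  by rewrite /G mulrBr mulrBl mulr1 mul1r mulrA -op_realC -!mulrA SH.
Qed.

(** Rescale to h = H / sqrt s. The root 1 - Y of 1 - h^2 commutes with h, and the two squares add up
    to 1, so [commuting_sa_le] bounds the root, hence its square, by 1. *)
Lemma op_le_sub_sq H s : 0 <= s -> opadj H = H -> op_le (H * H) s ->
  op_le (rs s - H * H) s.
Proof.
rewrite le_eqVlt => /orP[/eqP<- _ H0|s0 Ha Hs].
  by rewrite op_real0 sub0r; apply: op_leN.
have ss0 : 0 < Num.sqrt s by rewrite sqrtr_gt0.
pose h := rs (Num.sqrt s)^-1 * H.
have ha : opadj h = h by rewrite opadjM opadj_real Ha -op_realC.
have hh : rs s * (h * h) = H * H.
  rewrite op_real_mulM -invfM -expr2 sqr_sqrtr ?ltW // mulrA -op_realM.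
  by rewrite divff ?gt_eqF // op_real1 mul1r.
have h1 : op_le (h * h) 1.
  have h2 : op_le h 1.
    rewrite -(mulVf (lt0r_neq0 ss0)); apply: op_le_realM.
      by rewrite invr_ge0 ltW.
    by apply: op_le_sqrt => //; apply: ltW.
  by rewrite -[X in op_le _ X]mulr1; apply: op_leM.
have hha : opadj (h * h) = h * h by rewrite opadjM ha.
have [Y [Ya Y1 YG Yc]] := op_sqrt_contraction hha h1.
have K1 : op_le (1 - Y) 1.
  apply: (@commuting_sa_le _ _ _ h) => //.
  - by rewrite opadjD opadjN opadj1 Ya.
  - by rewrite mulrBr mulrBl mulr1 mul1r Yc // mulrA.
  - by rewrite YG subrK expr1n; apply: op_le_real.
rewrite -hh -{1}[rs s]mulr1 -mulrBr -YG -[X in op_le _ X]mulr1.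
apply: op_le_realM; first exact: ltW.
by rewrite -[X in op_le _ X]mulr1; apply: op_leM.
Qed.

Lemma op_pos_sq H : opadj H = H -> op_pos (H * H).
Proof.
move=> Ha; have [c c0 cP] := op_le_exists (H * H).
split; first by rewrite opadjM Ha.
by exists c; [exact: ltW|apply: op_le_sub_sq => //; apply: ltW].
Qed.

(** As the sum of [K] and s - (H + K), the operator s - H is positive. Thus [H] and s - H have
    commuting roots whose squares add up to s, and [commuting_sa_le] bounds the first root by sqrt
    s. *)
Lemma op_pos_mono H K s : 0 <= s -> op_pos H -> op_pos K -> op_le (H + K) s ->
  op_le H s.
Proof.
move=> s0 Hp Kp HKs; have [Ha Ka] := (op_pos_sa Hp, op_pos_sa Kp).
pose M := K + (rs s - (H + K)).
have Mp : op_pos M.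
  apply: op_posD => //; split.
    by rewrite opadjD opadjN opadjD opadj_real Ha Ka.
  by exists s => //; rewrite subKr.
have ME : M = rs s - H by rewrite /M addrC opprD addrA subrK.
have [U [Ua UH _ _]] := op_pos_sqrt Hp.
have [V [Va VM _ Vc]] := op_pos_sqrt Mp.
rewrite -UH -[s]sqr_sqrtr // expr2; suff U1 : op_le U (Num.sqrt s).
  by apply: op_leM => //; apply: sqrtr_ge0.
apply: (@commuting_sa_le _ _ _ V); rewrite ?sqrtr_ge0 //.
  by apply: Vc; rewrite ME mulrBr mulrBl op_realC -UH mulrA.
by rewrite UH VM ME subrKC sqr_sqrtr //; apply: op_le_real.
Qed.

(* With [D] the adjoint of [C], the spectrum of [C D] is nonnegative and that of
   [D C] nonpositive, although they agree away from 0. Comparing the norms of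
   [(s + C D)^2 C D] and [C (s + D C)^2 D] replaces this spectral argument. *)
Lemma op_neg_gram_eq0 C K : opadj K = K -> opadj C * C = - (K * K) -> C = 0.
Proof.
move=> Ka; set D := opadj C => DC.
have Da : opadj D = C by rewrite opadjK.
set p := C * D.
have pa : opadj p = p by rewrite opadjM Da.
(* Since D C = - K^2, 2 p = (C + D)^2 + (i (C - D))^2 + 2 K^2 is a sum of squares of self-adjoint
   operators. *)
have pp : op_pos p.
  have xa : opadj (C + D) = C + D by rewrite opadjD Da addrC.
  have ya : opadj (op_i A * (C - D)) = op_i A * (C - D).
    by rewrite opadjM opadjD opadjN Da opadj_i op_iC mulrN -mulNr opprB.
  rewrite -(op_real_half p); apply: op_posZ; first by lra.
  have -> : p + p = (C + D) * (C + D) + (op_i A * (C - D)) * (op_i A * (C - D))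
       + (K * K + K * K).
    rewrite op_i_mulM.
    have -> : K * K = - (D * C) by rewrite DC opprK.
    have sqD : (C + D) * (C + D) = C * C + D * D + (C * D + D * C).
      by rewrite mulrDl !mulrDr [D * C + D * D]addrC addrACA.
    have sqB : (C - D) * (C - D) = C * C + D * D - (C * D + D * C).
      by rewrite mulrBl !mulrBr opprB addrACA -opprD.
    rewrite sqD sqB opprB [C * D + D * C - _]addrC [X in _ = X + _]addrACA.
    by rewrite subrr add0r addrACA addrK.
  apply: op_posD; apply: op_posD; exact: op_pos_sq.
(* With E = s + D C, the operator C E^2 D = (s + p)^2 p has norm at most s^3. Dropping its positive
   terms s^2 p and p^3 leaves |2 s p^2| <= s^3, so |p|^2 <= s^2 / 2; 3 / 4 is a rational upper bound
   for 1 / sqrt 2. *)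
have step s : 0 <= s -> op_le p s -> op_le p (s * (3 / 4)).
  rewrite le_eqVlt => /orP[/eqP<-|s0 ps]; first by rewrite mul0r.
  have ss0 := sqrtr_ge0 s; have s0' := ltW s0.
  have Ds : op_le D (Num.sqrt s).
    by apply: op_le_cstar => //; rewrite Da sqr_sqrtr.
  have Cs : op_le C (Num.sqrt s) by rewrite -Da; apply: op_le_adj.
  pose E := rs s + D * C.
  have Es : op_le E s.
    rewrite /E DC; apply: op_le_sub_sq => //.
    rewrite -[K * K]opprK -DC; apply: op_leN.
    by rewrite -[s]sqr_sqrtr // expr2; apply: op_leM.
  have [u [ua uu _ _]] := op_pos_sqrt pp.
  have CEED : op_le (C * (E * (E * D))) (s ^+ 3).
    have -> : s ^+ 3 = Num.sqrt s * (s * (s * Num.sqrt s)).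
      by rewrite mulrC -!mulrA -expr2 sqr_sqrtr // !exprS expr0 mulr1.
    by do 3! [apply: op_leM => //].
  have CE : C * E = (rs s + p) * C by rewrite /E mulrDr mulrDl -op_realC mulrA.
  have r2 : op_le (rs s * (p * p) + rs s * (p * p)) (s ^+ 3).
    apply: (@op_pos_mono _ (rs s * (rs s * p) + p * (p * p))).
    - exact: exprn_ge0.
    - by apply: op_posD; apply: op_posZ => //; apply: op_pos_sq.
    - apply: op_posD; first by do 2! [apply: op_posZ => //].
      (* The cube of p is a square: u p is self-adjoint since p = u^2. *)
      have -> : p * (p * p) = (u * p) * (u * p).
        by rewrite -uu -!mulrA.
      by apply: op_pos_sq; rewrite opadjM pa ua -uu mulrA.
    have -> : rs s * (p * p) + rs s * (p * p) + (rs s * (rs s * p) + p * (p * p)) =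
        (rs s + p) * ((rs s + p) * p).
      rewrite mulrDl (mulrDl (rs s)) !mulrDr (mulrA p (rs s)) -(op_realC s p) -!mulrA.
      by rewrite [rs s * (rs s * p) + rs s * _]addrC addrACA.
    by move: CEED; rewrite mulrA CE -mulrA (mulrA C) CE -(mulrA _ C).
  have p2 : op_le (p * p) ((s * (3 / 4)) ^+ 2).
    rewrite -(op_real_half (p * p)).
    have -> : p * p + p * p = rs s^-1 * (rs s * (p * p) + rs s * (p * p)).
      by rewrite -[in RHS]mulrDr [RHS]mulrA -op_realM mulVf ?gt_eqF // op_real1 mul1r.
    apply: (@op_leW _ _ _ (2^-1 * (s^-1 * s ^+ 3))).
      by rewrite exprS mulKf ?gt_eqF // exprMn; nra.
    apply: op_le_realM; first by lra.
    by apply: op_le_realM => //; rewrite invr_ge0.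
  by apply: op_le_sa => //; apply: mulr_ge0 => //; lra.
have [s s0 ps] := op_le_exists p.
have iter n : op_le p (s * (3 / 4) ^+ n).
  elim: n => [|n IH]; first by rewrite expr0 mulr1.
  rewrite exprSr (mulrA s); apply: step => //.
  by apply: mulr_ge0; [exact: ltW|apply: exprn_ge0; lra].
have p0 : p = 0.
  have null34 : null_seq (fun n => (3 / 4 : R) ^+ n) by apply: null_seq_expr; lra.
  by apply: (op_null_eq (null_seqZ (ltW s0) null34)) => n; rewrite subr0.
have D0 : D = 0.
  apply/op_le0/op_le_cstar => //; rewrite Da -/p p0 expr0n.
  exact: op_le_real.
by rewrite -Da D0; apply: (opadj_real A 0).
Qed.

(** W is the absolute value of H, and N = W - H is twice the negative part of H. As N H = - N W and
    W = w^2, C = B N satisfies C^* C = N H N = - (N w)^2, so C = 0 by [op_neg_gram_eq0]. Then N w =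
    0, whence N^2 = 2 N W = 0, and H = W is positive. *)
Lemma op_gram_pos B : op_pos (opadj B * B).
Proof.
set H := opadj B * B; have Ha : opadj H = H by rewrite opadjM opadjK.
have [W [Wa WW Wp Wc]] := op_pos_sqrt (op_pos_sq Ha).
have [w [wa ww _ wc]] := op_pos_sqrt Wp.
have HW : H * W = W * H by apply: Wc; rewrite mulrA.
have Hw : H * w = w * H by apply: wc.
pose N := W - H; have Na : opadj N = N by rewrite opadjD opadjN Wa Ha.
have NH : N * H = - (N * W).
  by rewrite /N !mulrBl WW HW opprB.
have Nw : w * N = N * w by rewrite mulrBr mulrBl -Hw -ww mulrA.
have Ka : opadj (N * w) = N * w by rewrite opadjM Na wa.
have CC : opadj (B * N) * (B * N) = - (N * w * (N * w)).
  rewrite opadjM Na -mulrA (mulrA (opadj B)) -/H mulrA NH -ww mulNr.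
  by rewrite -!mulrA Nw.
have BN0 := op_neg_gram_eq0 Ka CC.
have K0 : N * w = 0.
  apply/op_le0/op_le_sa => //; rewrite -[N * w * _]opprK -CC BN0 mulr0 oppr0 expr0n.
  exact: op_le_real.
have NW0 : N * W = 0 by rewrite -ww mulrA K0 mul0r.
have N0 : N = 0.
  apply/op_le0/op_le_sa => //; rewrite {2}/N mulrBr NH NW0 oppr0 subr0 expr0n.
  exact: op_le_real.
by rewrite -(subr0_eq N0).
Qed.

End PositiveCone.

(** Left multiplication turns both elements into positive operators, to which [op_pos_mono]
    applies. *)
Lemma ca_norm_gram_le (R : realType) (A : cstar_alg R) (b d : A) :
  ca_norm (ca_mul (ca_star b) b) <=
  ca_norm (ca_mul (ca_star b) b + ca_mul (ca_star d) d).
Proof.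
set h := ca_mul (ca_star b) b; set k := ca_mul (ca_star d) d.
have gram c : opadj (op_lmul c) * op_lmul c = op_lmul (ca_mul (ca_star c) c).
  by apply: adjop_ext => a /=; rewrite ca_mulA.
have hs : op_le (op_lmul h) (ca_norm (h + k)).
  apply: (@op_pos_mono _ _ _ (op_lmul k)) => //; rewrite -?gram; try exact: op_gram_pos.
  by move=> a; rewrite !gram /= -ca_mulDl; apply: ca_normM.
(* Evaluated at [h] itself, in place of a unit, the bound reads |h|^2 <= |h + k| |h|. *)
have := hs h; have hh : ca_star h = h by rewrite /h ca_starM ca_starK.
rewrite /= -{1}hh ca_norm_starM expr2.
have := ca_norm_ge0 h; rewrite le_eqVlt => /orP[/eqP<- //|h0].
by rewrite ler_pM2r.
Qed.

(** * Cauchy-Schwarz and the norm of a Hilbert module *)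

Section HilbertModule.
Variables (R : realType) (A : cstar_alg R) (X : hmod A).
Implicit Types (x y z : X) (a b : A) (l : R[i]).

Let ax := hm_ax X.

Lemma hm_actDl a b x : hm_act (a + b) x = hm_act a x + hm_act b x.
Proof. by case: ax. Qed.
Lemma hm_actDr a x y : hm_act a (x + y) = hm_act a x + hm_act a y.
Proof. by case: ax => _ []. Qed.
Lemma hm_actZl l a x : hm_act (l *: a) x = l *: hm_act a x.
Proof. by case: ax => _ [_ [_ [/(_ l a x)[-> _]]]]. Qed.
Lemma hm_actZr l a x : hm_act a (l *: x) = l *: hm_act a x.
Proof. by case: ax => _ [_ [_ [/(_ l a x)[_ ->]]]]. Qed.
Lemma hm_ipDl x y z : hm_ip (x + y) z = hm_ip x z + hm_ip y z.
Proof. by case: ax => _ [_ [_ [_ []]]]. Qed.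
Lemma hm_ipZl l x y : hm_ip (l *: x) y = l *: hm_ip x y.
Proof. by case: ax => _ [_ [_ [_ [_ []]]]]. Qed.
Lemma hm_ip_actl a x y : hm_ip (hm_act a x) y = ca_mul a (hm_ip x y).
Proof. by case: ax => _ [_ [_ [_ [_ [_ []]]]]]. Qed.
Lemma hm_ip_star x y : ca_star (hm_ip x y) = hm_ip y x.
Proof. by case: ax => _ [_ [_ [_ [_ [_ [_ []]]]]]]. Qed.
Lemma hm_ip_positive x : ca_positive (hm_ip x x).
Proof. by case: ax => _ [_ [_ [_ [_ [_ [_ [_ [? _]]]]]]]]. Qed.
Lemma hm_ip_eq0 x : hm_ip x x = 0 -> x = 0.
Proof. by case: ax => _ [_ [_ [_ [_ [_ [_ [_ [_ [/(_ x)[? _] _]]]]]]]]]. Qed.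
Lemma hm_complete : complete_wrt (@hm_norm _ _ X).
Proof. by case: ax => _ [_ [_ [_ [_ [_ [_ [_ [_ [_ ?]]]]]]]]]. Qed.

Lemma hm_actN a x : hm_act (- a) x = - hm_act a x.
Proof. by rewrite -scaleN1r hm_actZl scaleN1r. Qed.
Lemma hm_actrN a x : hm_act a (- x) = - hm_act a x.
Proof. by rewrite -scaleN1r hm_actZr scaleN1r. Qed.
Lemma hm_ipN x y : hm_ip (- x) y = - hm_ip x y.
Proof. by rewrite -scaleN1r hm_ipZl scaleN1r. Qed.
Lemma hm_ipDr x y z : hm_ip x (y + z) = hm_ip x y + hm_ip x z.
Proof. by rewrite -hm_ip_star hm_ipDl ca_starD !hm_ip_star. Qed.
Lemma hm_ipZr l x y : hm_ip x (l *: y) = conjc l *: hm_ip x y.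
Proof. by rewrite -hm_ip_star hm_ipZl ca_starZ hm_ip_star. Qed.
Lemma hm_iprN x y : hm_ip x (- y) = - hm_ip x y.
Proof. by rewrite -hm_ip_star hm_ipN ca_starN hm_ip_star. Qed.
Lemma hm_ip_actr a x y : hm_ip x (hm_act a y) = ca_mul (hm_ip x y) (ca_star a).
Proof. by rewrite -hm_ip_star hm_ip_actl ca_starM hm_ip_star. Qed.

Lemma hm_norm_ge0 x : 0 <= hm_norm x. Proof. exact: sqrtr_ge0. Qed.

Lemma hm_norm_sqr x : hm_norm x ^+ 2 = ca_norm (hm_ip x x).
Proof. by rewrite sqr_sqrtr. Qed.

(* Expand [<z, z>] for [z = y - (r^2/2) <y, x> x]; this is positive and, once the
   cross terms are moved to the other side, so are all the summands. *)
Lemma hm_ip_young (r : R) x y :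
  r ^+ 2 * ca_norm (hm_ip y x) ^+ 2 <=
  (r ^+ 2 / 2) ^+ 2 * ca_norm (hm_ip y x) ^+ 2 * ca_norm (hm_ip x x)
  + ca_norm (hm_ip y y).
Proof.
set c := hm_ip y x; have cs : ca_star c = hm_ip x y by rewrite hm_ip_star.
(* With this t the two cross terms of <z, z> add up to - r^2 c c^*, and [b] is chosen so that b^* b
   cancels them. *)
have nA := ca_is_norm A; pose t := r ^+ 2 / 2.
pose z := y - t%:C *: hm_act c x; have [d zd] := hm_ip_positive z.
pose b := r%:C *: ca_star c.
have bb : ca_mul (ca_star b) b = (r ^+ 2)%:C *: ca_mul c (ca_star c).
  by rewrite ca_starZ conjc_real ca_starK ca_mulZl ca_mulZr scalerA -rmorphM.
have E : ca_mul (ca_star b) b + hm_ip z z =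
    (t ^+ 2)%:C *: ca_mul (ca_mul c (hm_ip x x)) (ca_star c) + hm_ip y y.
  rewrite bb /z hm_ipDl !hm_ipDr !hm_ipN !hm_iprN !hm_ipZl !hm_ipZr.
  rewrite !hm_ip_actl !hm_ip_actr -cs conjc_real opprK scalerA -rmorphM -expr2 ca_mulA.
  have -> : (r ^+ 2)%:C = t%:C + t%:C by rewrite -rmorphD /t; congr _%:C; lra.
  rewrite scalerDl (addrC _ (hm_ip y y)) -/c; set u := t%:C *: _; set v := _ *: _.
  by rewrite [hm_ip y y - u]addrC [- u + _ + _]addrACA -opprD addNKr.
have := ca_norm_gram_le b d; rewrite -zd E bb (norm_real_scale nA).
have -> : ca_norm (ca_mul c (ca_star c)) = ca_norm c ^+ 2.
  by rewrite -{1}(ca_starK c) ca_norm_starM ca_norm_star.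
rewrite ger0_norm ?sqr_ge0 // => /le_trans; apply.
apply: le_trans (norm_triangle nA _ _) _; rewrite lerD2r (norm_real_scale nA).
rewrite ger0_norm ?sqr_ge0 // -/t -(mulrA (t ^+ 2)).
apply: ler_wpM2l; first exact: sqr_ge0.
apply: le_trans (ca_normM _ _) _; rewrite ca_norm_star.
by have := ler_wpM2r (ca_norm_ge0 c) (ca_normM c (hm_ip x x)); lra.
Qed.

Lemma hm_cauchy_schwarz x y : ca_norm (hm_ip y x) <= hm_norm y * hm_norm x.
Proof.
have n0 := ca_norm_ge0; rewrite -(@ler_pXn2r _ 2) ?nnegrE ?mulr_ge0 ?hm_norm_ge0 //.
rewrite exprMn !hm_norm_sqr.
have := n0 _ A (hm_ip x x); rewrite le_eqVlt => /orP[/eqP p0|p0].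
  have -> : x = 0 by apply/hm_ip_eq0/(norm0_eq0 (ca_is_norm A)).
  have -> : hm_ip y 0 = 0 by rewrite -[X in hm_ip y X](scale0r (0 : X)) hm_ipZr conjc0 scale0r.
  by rewrite (norm_zero (ca_is_norm A)) expr0n mulr_ge0.
set p := ca_norm (hm_ip x x) in p0 *.
(* The optimal parameter: r^2 = 2 / p turns the inequality into (2 / p) N <= N / p + q, that is N <=
   p q. *)
have := hm_ip_young (Num.sqrt (2 / p)) x y.
have p2 : 0 <= 2 / p by apply: divr_ge0; [lra|apply: ltW].
rewrite sqr_sqrtr // -/p.
set N := ca_norm (hm_ip y x) ^+ 2; set q := ca_norm (hm_ip y y).
have -> : (2 / p / 2) ^+ 2 * N * p = N / p by field; rewrite gt_eqF.
move=> h; rewrite -ler_pdivrMr //; move: h; rewrite -[2 / p]mulrC -mulrA.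
by rewrite [p^-1 * (2 * _)]mulrCA; lra.
Qed.

Lemma hm_is_norm : is_norm (@hm_norm _ _ X).
Proof.
have nA := ca_is_norm A; split.
- exact: hm_norm_ge0.
- move=> x x0; apply/hm_ip_eq0/(norm0_eq0 nA); rewrite -hm_norm_sqr x0 expr0n //.
- move=> x y; have [x0 y0] := (hm_norm_ge0 x, hm_norm_ge0 y).
  rewrite -(@ler_pXn2r _ 2) ?nnegrE ?addr_ge0 ?hm_norm_ge0 //.
  rewrite hm_norm_sqr hm_ipDl !hm_ipDr sqrrD !hm_norm_sqr.
  have := norm_triangle nA (hm_ip x x + hm_ip x y) (hm_ip y x + hm_ip y y).
  have := norm_triangle nA (hm_ip x x) (hm_ip x y).
  have := norm_triangle nA (hm_ip y x) (hm_ip y y).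
  have := hm_cauchy_schwarz x y; have := hm_cauchy_schwarz y x; lra.
- move=> l x; rewrite /hm_norm hm_ipZl hm_ipZr !(norm_scale nA) cabs_conj mulrA -expr2.
  by rewrite sqrtrM ?sqr_ge0 // sqrtr_sqr ger0_norm // cabs_ge0.
Qed.

Lemma hm_norm_act a x : hm_norm (hm_act a x) <= ca_norm a * hm_norm x.
Proof.
rewrite -(@ler_pXn2r _ 2) ?nnegrE ?mulr_ge0 ?hm_norm_ge0 //.
rewrite exprMn !hm_norm_sqr hm_ip_actl hm_ip_actr.
apply: le_trans (ca_normM _ _) _.
have := ler_wpM2l (ca_norm_ge0 a) (ca_normM (hm_ip x x) (ca_star a)).
by rewrite ca_norm_star; lra.
Qed.

End HilbertModule.

(** * From unimodular scalars to all complex scalars *)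

Section UnimodularHomogeneity.
Variables (R : realType) (V W : lmodType R[i]) (H : V -> W).
Hypothesis HD : forall x y, H (x + y) = H x + H y.
Hypothesis H1 : forall (mu : R[i]) x, cabs mu = 1 -> H (mu *: x) = mu *: H x.

Lemma unimodular_homogeneous (l : R[i]) x : H (l *: x) = l *: H x.
Proof.
pose P (m : R[i]) := forall x, H (m *: x) = m *: H x.
have PD m n : P m -> P n -> P (m + n).
  by move=> Pm Pn z; rewrite !scalerDl HD Pm Pn.
have PM m n : P m -> P n -> P (m * n).
  by move=> Pm Pn z; rewrite -!scalerA Pm Pn.
have P1 : P 1 by move=> z; rewrite !scale1r.
have P0 : P 0.
  by move=> z; rewrite !scale0r; apply: (@addrI _ (H 0)); rewrite -HD !addr0.
have Pnat n : P n%:R.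
  by elim: n => [|n IH]; [exact: P0|rewrite -natr1; apply: PD].
(* Such a number is the sum of two conjugate unimodular numbers with real part t. *)
have Psmall (t : R) : `|t| <= 1 -> P (2 * t)%:C.
  move=> t1; have t2 : 0 <= 1 - t ^+ 2.
    by rewrite subr_ge0 -real_normK ?num_real // exprn_ile1.
  have -> : (2 * t)%:C = (t +i* Num.sqrt (1 - t ^+ 2)) + (t -i* Num.sqrt (1 - t ^+ 2)).
    by apply/eqP; rewrite eq_complex /= subrr eqxx andbT; apply/eqP; ring.
  by apply: PD => z; apply: H1; rewrite /= ?sqrrN sqr_sqrtr // subrKC sqrtr1.
have Preal (t : R) : P t%:C.
  have := archi_boundP (normr_ge0 t); set n := Num.Def.archi_bound _ => tn.
  have n0 : 0 < n%:R :> R by apply: le_lt_trans tn.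
  (* A natural multiple of a number covered by [Psmall], since n > |t|. *)
  have -> : t%:C = n%:R * (2 * (t / (2 * n%:R)))%:C.
    rewrite -(rmorph_nat (real_complex R)) -rmorphM; congr _%:C; field.
    by rewrite gt_eqF.
  apply: PM => //; apply: Psmall.
  rewrite normrM normfV (@ger0_norm _ (2 * _)); last by lra.
  by rewrite ler_pdivrMr; lra.
rewrite [l]complexE.
by apply: PD => //; apply: PM => // z; apply: H1; apply: cabs_i.
Qed.

End UnimodularHomogeneity.

(** * Continuity of the triple product <u, v> w *)

Section TripleProduct.
Variables (R : realType) (A : cstar_alg R) (Y : hmod A).
Implicit Types u v w : Y.

Lemma hm_norm_triple u v w :
  hm_norm (hm_act (hm_ip u v) w) <= hm_norm u * hm_norm v * hm_norm w.
Proof.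
apply: le_trans (hm_norm_act _ _) _; apply: ler_wpM2r; first exact: hm_norm_ge0.
exact: hm_cauchy_schwarz.
Qed.

(** The three factors are replaced one at a time. *)
Lemma hm_norm_triple_sub u v w u' v' w' :
  hm_norm (hm_act (hm_ip u v) w - hm_act (hm_ip u' v') w') <=
  hm_norm (u - u') * hm_norm v * hm_norm w + hm_norm u' * hm_norm (v - v') * hm_norm w
  + hm_norm u' * hm_norm v' * hm_norm (w - w').
Proof.
have -> : hm_act (hm_ip u v) w - hm_act (hm_ip u' v') w' =
   hm_act (hm_ip (u - u') v) w + hm_act (hm_ip u' (v - v')) w
   + hm_act (hm_ip u' v') (w - w').
  rewrite hm_ipDl hm_ipN hm_ipDr hm_iprN !hm_actDl hm_actDr !hm_actN hm_actrN.
  by rewrite !addrA !subrK.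
have nY := hm_is_norm Y.
apply: le_trans (norm_triangle nY _ _) _; apply: lerD; last exact: hm_norm_triple.
apply: le_trans (norm_triangle nY _ _) _; apply: lerD; exact: hm_norm_triple.
Qed.

End TripleProduct.

(** * Hyers' iteration and its limit *)

Section HyersIteration.
Variables (R : realType) (A B : cstar_alg R) (X : hmod A) (Y : hmod B).
Variables (f : X -> Y) (phi : X -> X -> X -> R) (L : R).
Hypothesis phi_ge0 : forall x y z, 0 <= phi x y z.
Hypothesis Hadd : forall (mu : R[i]) (x y : X), cabs mu = 1 ->
  hm_norm (f (mu *: x + y) - mu *: f x - f y) <= phi x y 0.
Hypothesis Hip : forall x y z : X,
  hm_norm (f (hm_act (hm_ip x y) z) - hm_act (hm_ip (f x) (f y)) (f z))
    <= phi x y z.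
Hypotheses (L_ge0 : 0 <= L) (L_lt1 : L < 1).
Hypothesis Hphi : forall x y z : X,
  phi x y z <= 2 * L * phi ((2 : R[i])^-1 *: x) ((2 : R[i])^-1 *: y)
                           ((2 : R[i])^-1 *: z).

Let nY := hm_is_norm Y.
Let L2_gt0 : 0 < 2 - 2 * L. Proof. by move: L_lt1; lra. Qed.
Let L2V_ge0 : 0 <= (2 - 2 * L)^-1. Proof. by rewrite invr_ge0 ltW. Qed.
Let two_neq0 : (2 : R[i]) != 0. Proof. by rewrite pnatr_eq0. Qed.

Lemma phi_pow2 n x y z :
  phi ((2 : R[i]) ^+ n *: x) ((2 : R[i]) ^+ n *: y) ((2 : R[i]) ^+ n *: z)
    <= (2 * L) ^+ n * phi x y z.
Proof.
elim: n => [|n IH]; first by rewrite !expr0 !scale1r mul1r.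
apply: le_trans (Hphi _ _ _) _; rewrite !scalerA !exprS !mulKf // -[X in _ <= X]mulrA.
by apply: ler_wpM2l => //; apply: mulr_ge0.
Qed.

Lemma half_real n : (2 : R[i])^-1 ^+ n = (2^-1 ^+ n)%:C.
Proof. by rewrite rmorphXn fmorphV rmorph_nat. Qed.

Let half_ge0 n : 0 <= 2^-1 ^+ n :> R.
Proof. by rewrite exprn_ge0 // invr_ge0 ler0n. Qed.

Definition hyers n x : Y := (2 : R[i])^-1 ^+ n *: f ((2 : R[i]) ^+ n *: x).

Lemma norm_half_scale n (v : Y) :
  hm_norm ((2 : R[i])^-1 ^+ n *: v) = 2^-1 ^+ n * hm_norm v.
Proof.
by rewrite half_real (norm_real_scale nY) ger0_norm.
Qed.

Lemma half_pow2L n : 2^-1 ^+ n * (2 * L) ^+ n = L ^+ n.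
Proof. by rewrite -exprMn mulKf ?pnatr_eq0. Qed.

(** At scale 2^n the control grows at most like (2 L)^n, and the factor 2^-n leaves L^n. The step,
    affine and triple-product defects are all bounded this way. *)
Lemma half_pow_scale_le n (v : Y) x y z :
  hm_norm v <= phi ((2 : R[i]) ^+ n *: x) ((2 : R[i]) ^+ n *: y) ((2 : R[i]) ^+ n *: z) ->
  hm_norm ((2 : R[i])^-1 ^+ n *: v) <= phi x y z * L ^+ n.
Proof.
move=> /le_trans/(_ (phi_pow2 n x y z)) vL; rewrite norm_half_scale.
apply: le_trans (ler_wpM2l _ vL) _; first exact: half_ge0.
by rewrite mulrA half_pow2L mulrC.
Qed.

(** For w = 2^n x, f (2 w) - 2 f w is the additivity defect at mu = 1; the extra 1 / 2 comes from
    the exponent n + 1. *)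
Lemma hyers_step n x :
  hm_norm (hyers n x - hyers n.+1 x) <= phi x x 0 * L ^+ n / 2.
Proof.
set w := (2 : R[i]) ^+ n *: x.
have w2 : (2 : R[i]) ^+ n.+1 *: x = 1 *: w + w.
  by rewrite exprS -scalerA scaler_nat mulr2n scale1r.
have c1 : cabs (1 : R[i]) = 1 by rewrite (cabs_real 1) normr1.
have -> : hyers n x - hyers n.+1 x = (2 : R[i])^-1 ^+ 1 *:
   ((2 : R[i])^-1 ^+ n *: - (f (1 *: w + w) - 1 *: f w - f w)).
  rewrite /hyers w2 -/w scale1r (scale1r (f w)) expr1 scalerA -exprS.
  rewrite -addrA -opprD opprB scalerBr -[f w + f w]mulr2n -[f w *+ 2]scaler_nat scalerA.
  by have -> : (2 : R[i])^-1 ^+ n.+1 * 2 = (2 : R[i])^-1 ^+ n by rewrite exprSr mulfVK.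
rewrite norm_half_scale expr1 mulrC; apply: ler_wpM2r; first by lra.
apply: half_pow_scale_le; rewrite (norm_opp nY) scaler0; exact: Hadd.
Qed.

Lemma hyers_cauchy x n m : (n <= m)%N ->
  hm_norm (hyers n x - hyers m x) <= (2 - 2 * L)^-1 * phi x x 0 * L ^+ n.
Proof.
move=> nm; set k := _ * phi x x 0.
have kE : phi x x 0 = k * (2 - 2 * L).
  by rewrite /k mulrAC mulVf ?mul1r // gt_eqF.
have k0 : 0 <= k by apply: mulr_ge0.
(* The difference L^n - L^m comes from summing the steps as a geometric series, and lets the
   induction on [m] telescope. *)
suff : hm_norm (hyers n x - hyers m x) <= k * (L ^+ n - L ^+ m).
  by move=> /le_trans; apply; apply: ler_wpM2l => //; rewrite gerBl exprn_ge0.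
elim: m nm => [|m IH]; first by rewrite leqn0 => /eqP->; rewrite !subrr (norm_zero nY) mulr0.
rewrite leq_eqVlt => /orP[/eqP->|/IH h]; first by rewrite !subrr (norm_zero nY) mulr0.
apply: le_trans (norm_dist_triangle nY (hyers m x) _ _) _.
by have := hyers_step m x; rewrite kE exprS; lra.
Qed.

(** The rate is kept for every n: n = 0 is the estimate of the theorem, as [hyers 0 x] is [f x], and
    the decay gives the algebraic properties and uniqueness. *)
Lemma hyers_limit : exists H : X -> Y, forall x n,
  hm_norm (hyers n x - H x) <= (2 - 2 * L)^-1 * phi x x 0 * L ^+ n.
Proof.
suff /choice[H HP] : forall x, exists v : Y, forall n,
    hm_norm (hyers n x - v) <= (2 - 2 * L)^-1 * phi x x 0 * L ^+ n by exists H.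
move=> x; apply: (complete_rate nY (@hm_complete _ _ Y)) => [|n m]; last exact: hyers_cauchy.
apply: null_seqZ (null_seq_expr L_ge0 L_lt1).
by apply: mulr_ge0.
Qed.

Variable H : X -> Y.
Hypothesis HP : forall x n,
  hm_norm (hyers n x - H x) <= (2 - 2 * L)^-1 * phi x x 0 * L ^+ n.

Let k x := (2 - 2 * L)^-1 * phi x x 0.

Let k_ge0 x : 0 <= k x.
Proof. by apply: mulr_ge0. Qed.

Let HP' x n : hm_norm (H x - hyers n x) <= k x * L ^+ n.
Proof. by rewrite (norm_distC nY); apply: HP. Qed.

Lemma eq_of_geometric_bound (u v : Y) c : 0 <= c ->
  (forall n, hm_norm (u - v) <= c * L ^+ n) -> u = v.
Proof.
by move=> c0; apply: (norm_null_eq nY (null_seqZ c0 (null_seq_expr L_ge0 L_lt1))).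
Qed.

Lemma hyers_limit_affine mu x y : cabs mu = 1 -> H (mu *: x + y) = mu *: H x + H y.
Proof.
(* The constant collects the errors of the three limits and the defect of the n-th iterate, each
   decaying like L^n. *)
move=> mu1; apply: (@eq_of_geometric_bound _ _
  (k (mu *: x + y) + phi x y 0 + k x + k y)) => [|n]; first by rewrite !addr_ge0.
have defect : hm_norm (hyers n (mu *: x + y) - mu *: hyers n x - hyers n y)
    <= phi x y 0 * L ^+ n.
  have -> : hyers n (mu *: x + y) - mu *: hyers n x - hyers n y =
     (2 : R[i])^-1 ^+ n *: (f (mu *: ((2 : R[i]) ^+ n *: x) + (2 : R[i]) ^+ n *: y)
       - mu *: f ((2 : R[i]) ^+ n *: x) - f ((2 : R[i]) ^+ n *: y)).
    by rewrite /hyers !scalerBr scalerDr !scalerA !(mulrC mu).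
  by apply: half_pow_scale_le; rewrite scaler0; apply: Hadd.
have -> : H (mu *: x + y) - (mu *: H x + H y) =
   (H (mu *: x + y) - hyers n (mu *: x + y))
   + (hyers n (mu *: x + y) - mu *: hyers n x - hyers n y)
   + mu *: (hyers n x - H x) + (hyers n y - H y).
  rewrite scalerBr !addrA subrK [_ - hyers n y + _]addrAC subrK.
  by rewrite [_ - hyers n y - _]addrAC subrK opprD addrA.
rewrite !mulrDl; apply: le_trans (norm_triangle nY _ _) (lerD _ (HP y n)).
apply: le_trans (norm_triangle nY _ _) (lerD _ _).
  exact: le_trans (norm_triangle nY _ _) (lerD (HP' _ n) defect).
by rewrite (norm_scale nY) mu1 mul1r; apply: HP.
Qed.

Lemma hyers_limit_additive x y : H (x + y) = H x + H y.
Proof.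
rewrite -[x in LHS]scale1r hyers_limit_affine ?scale1r //.
by rewrite (cabs_real 1) normr1.
Qed.

Lemma hyers_limit_homogeneous l x : H (l *: x) = l *: H x.
Proof.
apply: unimodular_homogeneous => [|mu y mu1]; first exact: hyers_limit_additive.
have H0 : H 0 = 0 by apply: (@addrI _ (H 0)); rewrite -hyers_limit_additive !addr0.
by rewrite -[mu *: y]addr0 hyers_limit_affine // H0 addr0.
Qed.

Let pow_le1 n : L ^+ n <= 1. Proof. by apply: exprn_ile1 => //; apply: ltW. Qed.

(** Scaling all three entries by 2^n scales the triple product by 2^(3n), hence the index
    [n * 3]. *)
Lemma hyers_triple_defect n x y z :
  hm_norm (hyers (n * 3) (hm_act (hm_ip x y) z)
    - hm_act (hm_ip (hyers n x) (hyers n y)) (hyers n z)) <= phi x y z * L ^+ n.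
Proof.
have conj2 : conjc ((2 : R[i]) ^+ n) = (2 : R[i]) ^+ n.
  by rewrite -(rmorph_nat (real_complex R)) -rmorphXn conjc_real.
have conjV : conjc ((2 : R[i])^-1 ^+ n) = (2 : R[i])^-1 ^+ n.
  by rewrite half_real conjc_real.
pose s := (2 : R[i]) ^+ n.
have -> : hyers (n * 3) (hm_act (hm_ip x y) z)
    - hm_act (hm_ip (hyers n x) (hyers n y)) (hyers n z) =
  (2 : R[i])^-1 ^+ (n * 2) *: ((2 : R[i])^-1 ^+ n *:
    (f (hm_act (hm_ip (s *: x) (s *: y)) (s *: z))
     - hm_act (hm_ip (f (s *: x)) (f (s *: y))) (f (s *: z)))).
  rewrite /hyers !hm_ipZl !hm_ipZr conjV !hm_actZr !hm_actZl.
  rewrite conj2 -/s !scalerBr !scalerA.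
  by rewrite /s !mulnS muln0 addn0 !exprD !mulrA.
(* One factor 2^-n turns the control into phi L^n; the remaining 2^(-2n) is at most 1. *)
rewrite norm_half_scale; apply: le_trans (half_pow_scale_le (Hip _ _ _)).
rewrite -[X in _ <= X]mul1r; apply: ler_wpM2r; first exact: hm_norm_ge0.
by apply: exprn_ile1; lra.
Qed.

Lemma hyers_limit_triple x y z :
  H (hm_act (hm_ip x y) z) = hm_act (hm_ip (H x) (H y)) (H z).
Proof.
have N0 v := hm_norm_ge0 (v : Y).
set w := hm_act (hm_ip x y) z.
(* Bounds, uniform in n, for the norms of the iterates at y and z. *)
pose my := hm_norm (H y) + k y; pose mz := hm_norm (H z) + k z.
have my0 : 0 <= my by apply: addr_ge0.
have mz0 : 0 <= mz by apply: addr_ge0.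
have hyers_le v n : hm_norm (hyers n v) <= hm_norm (H v) + k v.
  have := norm_triangle nY (H v) (hyers n v - H v); rewrite subrKC.
  have := ler_wpM2l (k_ge0 v) (pow_le1 n); have := HP v n; rewrite -/(k v); lra.
apply: (@eq_of_geometric_bound _ _ (k w + phi x y z + (k x * my * mz
  + hm_norm (H x) * k y * mz + hm_norm (H x) * hm_norm (H y) * k z))) => [|n].
  by rewrite !addr_ge0 ?mulr_ge0.
apply: le_trans (norm_dist_triangle nY (hyers (n * 3) w) _ _) _.
rewrite mulrDl mulrDl -addrA; apply: lerD.
  apply: le_trans (HP' _ _) _; apply: ler_wpM2l => //.
  (* At index 3 n the rate is L^(3n), which is at most L^n. *)
  rewrite exprM; have := pow_le1 n; have : 0 <= L ^+ n by exact: exprn_ge0.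
  by move: (L ^+ n) => e e0 e1; rewrite exprS ler_piMr // exprn_ile1.
apply: le_trans (norm_dist_triangle nY _ _ _) _; apply: lerD; first exact: hyers_triple_defect.
apply: le_trans (hm_norm_triple_sub _ _ _ _ _ _) _; rewrite !mulrDl.
apply: lerD; first apply: lerD.
- have -> : k x * my * mz * L ^+ n = k x * L ^+ n * my * mz by ring.
  apply: ler_pM => //; first exact: mulr_ge0.
  by apply: ler_pM => //; apply: HP.
- have -> : hm_norm (H x) * k y * mz * L ^+ n =
    hm_norm (H x) * (k y * L ^+ n) * mz by ring.
  apply: ler_pM => //; first exact: mulr_ge0.
  by apply: ler_wpM2l => //; apply: HP.
- rewrite -(mulrA _ (k z)); apply: ler_wpM2l; [exact: mulr_ge0|exact: HP].
Qed.

(** By homogeneity H' x = 2^-n H' (2^n x), so the assumed estimate at 2^n x, divided by 2^n, places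
    H' x within [k x * L ^+ n] of [hyers n x]. *)
Lemma hyers_limit_unique H' : hilbert_hom H' ->
  (forall x, hm_norm (f x - H' x) <= (2 - 2 * L)^-1 * phi x x 0) -> H' = H.
Proof.
move=> [_ [H'Z _]] H'f; apply/funext => x.
apply: (@eq_of_geometric_bound _ _ (k x + k x)) => [|n]; first exact: addr_ge0.
apply: le_trans (norm_dist_triangle nY (hyers n x) _ _) _.
rewrite mulrDl; apply: lerD; last exact: HP.
have -> : H' x - hyers n x = (2 : R[i])^-1 ^+ n *:
    (H' ((2 : R[i]) ^+ n *: x) - f ((2 : R[i]) ^+ n *: x)).
  by rewrite scalerBr H'Z scalerA -exprMn mulVf // expr1n scale1r.
rewrite norm_half_scale (norm_distC nY).
apply: le_trans (ler_wpM2l _ (H'f _)) _; first exact: half_ge0.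
have := phi_pow2 n x x 0; rewrite scaler0 => h.
rewrite mulrCA /k -mulrA; apply: ler_wpM2l; first exact: L2V_ge0.
apply: le_trans (ler_wpM2l _ h) _; first exact: half_ge0.
by rewrite mulrA half_pow2L mulrC.
Qed.

End HyersIteration.

Theorem theorem2p2 (R : realType) (A B : cstar_alg R) (X : hmod A) (Y : hmod B)
    (f : X -> Y) (phi : X -> X -> X -> R)
    (phi_ge0 : forall x y z, 0 <= phi x y z)
    (Hadd : forall (mu : R[i]) (x y : X), cabs mu = 1 ->
       hm_norm (f (mu *: x + y) - mu *: f x - f y) <= phi x y 0)
    (Hip : forall x y z : X,
       hm_norm (f (hm_act (hm_ip x y) z) - hm_act (hm_ip (f x) (f y)) (f z))
         <= phi x y z)
    (L : R) (L_ge0 : 0 <= L) (L_lt1 : L < 1)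
    (Hphi : forall x y z : X,
       phi x y z <= 2 * L * phi ((2 : R[i])^-1 *: x) ((2 : R[i])^-1 *: y)
                                ((2 : R[i])^-1 *: z)) :
  exists H : X -> Y,
    [/\ hilbert_hom H,
        (forall x, hm_norm (f x - H x) <= (2 - 2 * L)^-1 * phi x x 0) &
        (forall H' : X -> Y, hilbert_hom H' ->
           (forall x, hm_norm (f x - H' x) <= (2 - 2 * L)^-1 * phi x x 0) ->
           H' = H)].
Proof.
have [H HP] := hyers_limit phi_ge0 Hadd L_ge0 L_lt1 Hphi.
exists H; split.
- split; first exact: hyers_limit_additive HP.
  by split; [apply: hyers_limit_homogeneous HP|apply: hyers_limit_triple HP].
- by move=> x; have := HP x 0%N; rewrite /hyers !expr0 !scale1r mulr1.
- by move=> H' homH' H'f; apply: hyers_limit_unique HP _ homH' H'f.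
Qed.
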